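(* Let $X$ be a Hausdorff space. Then $|X|\le\pi w(X)^{\mathrm{ot}(X)\cdot\psi_c(X)}$.
   Context: - $\pi w(X)$ ($\pi$-weight) is $\min\{|\mathcal{V}|:\mathcal{V}\text{ is a }\pi\text{-base for }X\}+\omega$, where a $\pi$-base for $X$ is a collection $\mathcal{V}$ of non-empty open sets in $X$ such that every non-empty open set in $X$ contains some $V\in\mathcal{V}$. - $\mathrm{ot}(X)$ (o-tightness) is the smallest infinite cardinal $\kappa$ such that for every family $\mathcal{U}$ of open subsets of $X$ and every $x\in\overline{\bigcup\mathcal{U}}$ there is $\mathcal{V}\subset\mathcal{U}$ with $|\mathcal{V}|\le\kappa$ and $x\in\overline{\bigcup\mathcal{V}}$. - $\psi_c(X)$ (closed pseudocharacter, for Hausdorff $X$) is the smallest infinite cardinal $\kappa$ such that for each $x\in X$ there is a collection $\{V(\eta,x):\eta<\kappa\}$ of open neighborhoods of $x$ with $\bigcap_{\eta<\kappa}\overline{V(\eta,x)}=\{x\}$. *)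

(* Defs.v *)
From HB Require Import structures.
From mathcomp Require Import all_boot all_order.
From mathcomp Require Import all_classical topology.

Set Implicit Arguments.
Unset Strict Implicit.
Unset Printing Implicit Defensive.

Local Open Scope classical_set_scope.
Local Open Scope card_scope.

(* A cardinal is represented by a type, taken up to equipotence: sums, products
   and powers of cardinals are the types A + B, A * B and B -> A, and the order
   is [set: A] #<= [set: B]. *)

Definition is_least_card (P : Type -> Prop) (K : Type) : Prop :=
  P K /\ forall L : Type, P L -> [set: K] #<= [set: L].

(* The value void is taken only if no cardinal satisfies P, see [least_cardP]. *)
Definition least_card (P : Type -> Prop) : Type :=
  if pselect (exists K, is_least_card P K) is left e then projT1 (cid e)
  else void.

Definition infinite_card (K : Type) : Prop := infinite_set [set: K].

Section CardinalFunctions.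
Variable X : topologicalType.

Definition pi_base (V : set (set X)) : Prop :=
  (forall v, V v -> open v /\ v !=set0) /\
  (forall U : set X, open U -> U !=set0 -> exists2 v, V v & v `<=` U).

Definition pi_weight : Type :=
  (least_card (fun K => exists2 V, pi_base V & V #= [set: K]) + nat)%type.

Definition o_tight (K : Type) : Prop :=
  forall (U : set (set X)) (x : X), U `<=` open ->
    closure (\bigcup_(u in U) u) x ->
    exists V : set (set X),
      [/\ V `<=` U, V #<= [set: K] & closure (\bigcup_(v in V) v) x].

Definition o_tightness : Type :=
  least_card (fun K => infinite_card K /\ o_tight K).

Definition closed_pseudo (K : Type) : Prop :=
  forall x : X, exists V : K -> set X,
    (forall eta, open_nbhs x (V eta)) /\
    \bigcap_eta closure (V eta) = [set x].

Definition closed_pseudocharacter : Type :=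
  least_card (fun K => infinite_card K /\ closed_pseudo K).

End CardinalFunctions.

Lemma inj_card_leT (A B : Type) (f : A -> B) :
  injective f -> [set: A] #<= [set: B].
Proof.
move=> fi.
elim/Ppointed: B f fi => B f fi.
  suff -> : [set: A] = set0 by [].
  by rewrite -subset0 => a _; have := no (f a).
by apply/pcard_injP; exists f => x y _ _; exact: fi.
Qed.

(* Among nonempty families of subsets of T, one has least cardinality: take a
   maximal set of choice functions all of whose evaluations are injective. *)
Lemma least_subset (T : Type) (F : set (set T)) : F !=set0 ->
  exists2 A, F A & forall B, F B -> A #<= B.
Proof.
move=> [A0 FA0]; case: (pselect (F set0)) => [F0|nF0]; first by exists set0.
have T0 : T by case: (pselect (A0 !=set0)) => [/cid[]//|/set0P/negP/negPn/eqP E];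
  by exfalso; apply: nF0; rewrite -E.
pose good (S : set (set T -> T)) :=
  (forall s A, S s -> F A -> A (s A)) /\
  (forall A s t, F A -> S s -> S t -> s A = t A -> s = t).
have [G Ggood Gtot|S [[Sin Sinj] Smax]] := @Zorn_bigcup _ good.
  split=> [s A [S GS Ss] FA|A s t FA [S GS Ss] [S' GS' S't] e].
    exact: (Ggood _ GS).1 Ss FA.
  have [SS'|S'S] := Gtot _ _ GS GS'.
    exact: (Ggood _ GS').2 FA (SS' _ Ss) S't e.
  exact: (Ggood _ GS).2 FA Ss (S'S _ S't) e.
have [A FA Asurj] : exists2 A, F A & forall a, A a -> exists2 s, S s & s A = a.
  apply: contrapT => no_surj.
  have miss A : exists a, F A -> A a /\ forall s, S s -> s A <> a.
    case: (pselect (F A)) => [FA|]; last by exists T0.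
    apply: contrapT => h; apply: no_surj; exists A => // a Aa.
    apply: contrapT => h'; apply: h; exists a => _; split=> // s Ss e.
    by apply: h'; exists s.
  pose m A := projT1 (cid (miss A)).
  have mP A : F A -> A (m A) /\ forall s, S s -> s A <> m A.
    by move=> FA; exact: (projT2 (cid (miss A)) FA).
  apply: (Smax (S `|` [set m])).
    split; first by move=> s; left.
    by move=> /(_ m (or_intror erefl)) Sm; exact: ((mP _ FA0).2 m Sm).
  split=> [s A [Ss|->] FA|A s t FA [Ss|->] [St|->] //].
  - exact: Sin Ss FA.
  - exact: (mP _ FA).1.
  - exact: Sinj FA Ss St.
  - by move=> e; have := (mP _ FA).2 _ Ss.
  - by move=> /esym e; have := (mP _ FA).2 _ St.
exists A => // B FB.
have gE a : exists s, A a -> S s /\ s A = a.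
  case: (pselect (A a)) => [/Asurj[s Ss e]|nA]; first by exists s.
  by exists (fun=> T0).
pose g a := projT1 (cid (gE a)).
have gP a : A a -> S (g a) /\ g a A = a by move=> Aa; exact: (projT2 (cid (gE a)) Aa).
pose h (a : A) : B :=
  SigSub (mem_set (Sin (g (val a)) B (gP (val a) (set_mem (valP a))).1 FB)).
suff /inj_card_leT : injective h.
  by rewrite (card_le_eql (card_setT A)) (card_le_eqr (card_setT B)).
move=> a b /(congr1 val)/= e; apply: val_inj.
have [Sa ea] := gP _ (set_mem (valP a)).
have [Sb eb] := gP _ (set_mem (valP b)).
by rewrite -ea -eb (Sinj _ _ _ FB Sa Sb e).
Qed.

Lemma card_le_total (A B : Type) :
  [set: A] #<= [set: B] \/ [set: B] #<= [set: A].
Proof.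
pose F := [set range (@inl A B); range (@inr A B)].
have eA : range (@inl A B) #= [set: A] by apply: inj_card_eq => x y _ _ [].
have eB : range (@inr A B) #= [set: B] by apply: inj_card_eq => x y _ _ [].
have [|C [->|->] Cmin] := @least_subset _ F; first by exists (range inl); left.
- by left; rewrite -(card_le_eql eA) -(card_le_eqr eB); apply: Cmin; right.
- by right; rewrite -(card_le_eql eB) -(card_le_eqr eA); apply: Cmin; left.
Qed.

Lemma least_cardP (P : Type -> Prop) :
  (exists K, P K) -> is_least_card P (least_card P).
Proof.
move=> [K0 PK0]; rewrite /least_card; case: pselect => [e|]; last first.
  case; pose F := [set A : set K0 | exists2 L, P L & [set: L] #= A].
  have [|A [K PK KA] Amin] := @least_subset _ F; first by exists setT, K0.
  exists K; split=> // L PL; rewrite (card_le_eql KA).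
  have [LK0|K0L] := card_le_total L K0; last by apply: card_le_trans K0L; exact: card_leT.
  have [f] := card_leP LK0.
  pose g (x : L) : K0 := val (f (SigSub (mem_set (I : [set: L] x)))).
  have gi : injective g.
    move=> x y /val_inj e.
    by have /(congr1 val) := 'inj_f (in_setT _) (in_setT _) e.
  have gL : range g #= [set: L] by apply: inj_card_eq => x y _ _ /gi.
  by rewrite -(card_le_eqr gL); apply: Amin; exists L; rewrite // card_eq_sym.
exact: (projT2 (cid e)).
Qed.

Lemma pi_weightP (X : topologicalType) : exists2 K : Type,
  is_least_card (fun K => exists2 V : set (set X), pi_base V & V #= [set: K]) K
  & pi_weight X = (K + nat)%type.
Proof.
eexists; last by []; apply: least_cardP.
pose V := [set v : set X | open v /\ v !=set0].
exists V, V; last exact: card_setT_sym.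
by split=> // U Uo U0; exists U.
Qed.

Lemma infinite_card_set (T : Type) : infinite_card (T + nat).
Proof.
move=> fin; apply: infinite_nat; apply: (card_le_finite _ fin).
by apply: (@inj_card_leT _ _ inr) => x y [].
Qed.

Lemma o_tightnessP (X : topologicalType) :
  is_least_card (fun K => infinite_card K /\ o_tight X K) (o_tightness X).
Proof.
apply: least_cardP; exists (set X + nat)%type; split.
  exact: infinite_card_set.
move=> U x _ Ux; exists U; split=> //; apply: card_le_trans (card_leT U) _.
by apply: (@inj_card_leT _ _ inl) => u v [].
Qed.

Lemma closed_pseudocharacterP (X : topologicalType) : hausdorff_space X ->
  is_least_card (fun K => infinite_card K /\ closed_pseudo X K)
    (closed_pseudocharacter X).
Proof.
move=> hX; apply: least_cardP; exists (set X + nat)%type; split.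
  exact: infinite_card_set.
move=> x; pose V (e : set X + nat) :=
  if e is inl A then (if pselect (open_nbhs x A) then A else setT) else setT.
have oT : open_nbhs x [set: X] by split; [exact: openT|].
exists V; split=> [[A|n] //=|]; first by case: pselect.
apply/seteqP; split=> [y Vy|_ -> e _]; last first.
  by apply: subset_closure; rewrite /V; case: e => // A; case: pselect => // -[].
apply/esym/hX => A B; rewrite nbhsE => -[A' xA' A'A] yB.
have := Vy (inl A') I; rewrite /= /V; case: pselect => // _ /(_ _ yB)[z [A'z Bz]].
by exists z; split=> //; exact: A'A.
Qed.

(* Main.v *)
Require Import Defs.
From mathcomp Require Import all_boot all_order.
From mathcomp Require Import all_classical topology.

Local Open Scope classical_set_scope.
Local Open Scope card_scope.

(** Fix a pi-base [V] of least cardinality and, at each point [x], open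
neighborhoods [N eta], with [eta] ranging over the closed pseudocharacter,
whose closures meet in [x] only. The members of [V] inside [N eta] have a union
that is dense in [N eta] ([pi_base_closure]), so o-tightness gives a subfamily
indexed by the o-tightness whose union [B eta] still has [x] in its closure
([o_tight_enum]). As [B eta] is included in [N eta], the closures of the sets
[B eta] also meet in [x] only. Hence the map from o-tightness times closed
pseudocharacter to [V] that enumerates all these subfamilies determines [x]
([pi_base_code]), and there are at most as many points as such maps. *)

Lemma pi_base_closure (X : topologicalType) (V : set (set X)) (U : set X)
    (x : X) : pi_base V -> open U -> U x ->
  closure (\bigcup_(v in [set v | V v /\ v `<=` U]) v) x.
Proof.
move=> [Vo Vb] oU Ux A; rewrite nbhsE => -[A' [oA' A'x] A'A].
have [|v Vv vUA] := Vb (U `&` A') (openI oU oA'); first by exists x.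
have [z vz] := (Vo v Vv).2.
have vU : v `<=` U by move=> t /vUA[].
by exists z; split; [exists v|apply: A'A; have [] := vUA z vz].
Qed.

(** The subfamily given by o-tightness has a point in the closure of its union,
hence is nonempty, and so it can be enumerated by the whole of [K]. *)
Lemma o_tight_enum (X : topologicalType) (K : Type) (U : set (set X)) (x : X) :
  o_tight X K -> U `<=` open -> closure (\bigcup_(u in U) u) x ->
  exists g : K -> set X, (forall k, U (g k)) /\ closure (\bigcup_k g k) x.
Proof.
move=> tK Uo Ux; have [W [WU WK Wx]] := tK U x Uo Ux.
have /pfcard_geP[W0|[g]] := WK.
  by move: Wx; rewrite W0 bigcup_set0 closure0.
exists g; split=> [k|]; first by apply: WU; exact: funS.
apply: closureS Wx => z [w Ww wz].
by have [k _ gk] := 'surj_g Ww; exists k => //; rewrite gk.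
Qed.

Lemma pi_base_code (X : topologicalType) (V : set (set X)) (K L : Type)
    (x : X) : pi_base V -> o_tight X K -> closed_pseudo X L ->
  exists g : K * L -> set X, (forall i, V (g i)) /\
    \bigcap_eta closure (\bigcup_k g (k, eta)) = [set x].
Proof.
move=> Vb tK pL; have [N [Nx Ncap]] := pL x.
have step eta : exists g : K -> set X,
    (forall k, V (g k) /\ g k `<=` N eta) /\ closure (\bigcup_k g k) x.
  have [oN Nex] := Nx eta.
  apply: (@o_tight_enum X K [set v | V v /\ v `<=` N eta]) => //.
    by move=> v [/Vb.1[]].
  exact: pi_base_closure.
have [g gP] := choice step.
exists (fun i => g i.2 i.1); split=> [[k eta]|].
  exact: ((gP eta).1 k).1.
apply/seteqP; split=> [y gy|_ -> eta _]; last exact: (gP eta).2.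
rewrite -Ncap => eta _; apply: closureS (gy eta I) => z [k _].
exact: ((gP eta).1 k).2.
Qed.

Theorem theorem5p11 (X : topologicalType) (hX : hausdorff_space X) :
  [set: X] #<=
  [set: (o_tightness X * closed_pseudocharacter X)%type -> pi_weight X].
Proof.
have [[_ tK] _] := o_tightnessP X.
have [[_ pL] _] := closed_pseudocharacterP hX.
have [K [[V Vb VK] _] ->] := pi_weightP X.
have [c cP] := choice (fun x => pi_base_code X V _ _ x Vb tK pL).
have VKn : V #<= [set: K + nat].
  rewrite (card_le_eql VK).
  by apply: (@inj_card_leT _ _ inl) => a b [].
have [h] := card_leP VKn.
pose code x i : K + nat :=
  val (h (SigSub (mem_set ((cP x).1 i)))).
apply: (@inj_card_leT _ _ code) => x y e.
have exy : c x = c y.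
  apply/funext => i; have /val_inj := congr1 (@^~ i) e.
  by move/('inj_h (in_setT _) (in_setT _))/(congr1 val).
suff : [set y] x by [].
by rewrite -(cP y).2 -exy (cP x).2.
Qed.
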